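(* If $x\in\mathbb R^2$ and $\operatorname{rank}(G_x)=2$, then $\operatorname{orb}(x)=\{x'\in\mathbb R^2\mid (G_x,c_x)=(G_{x'},c_{x'})\}$.
   Context: Orbits: $\mathcal G_2=GL(2,\mathbb Z)\ltimes\mathbb Z^2$ is the group of affine transformations of $\mathbb R^2$ of the form $x\mapsto Ux+t$, with $t\in\mathbb Z^2$ and $U$ an integer $2\times2$ matrix with $\det(U)=\pm1$; $\operatorname{orb}(x)=\{\gamma(x)\mid\gamma\in\mathcal G_2\}$. For $x=(x_1,x_2)\in\mathbb R^2$, $G_x=\mathbb Z+\mathbb Zx_1+\mathbb Zx_2\subseteq\mathbb R$, and $\operatorname{rank}(G_x)$ is its rank as a free abelian group; equality $G_x=G_{x'}$ means equality as subsets of $\mathbb R$. Regular simplexes: a point $y\in\mathbb R^n$ is rational if all its coordinates are rational; its denominator $\operatorname{den}(y)$ is the least common denominator of its coordinates; its homogeneous correspondent is $\tilde y=\operatorname{den}(y)\,(y,1)\in\mathbb Z^{n+1}$. A simplex $\operatorname{conv}(v_0,\ldots,v_k)\subseteq\mathbb R^n$ with rational vertices is regular if $\{\tilde v_0,\ldots,\tilde v_k\}$ can be extended to a basis of the free abelian group $\mathbb Z^{n+1}$. The integer $c_x$: a rational hyperplane in $\mathbb R^n$ is a set $\{z\in\mathbb R^n\mid h\cdot z=k\}$ with $0\neq h\in\mathbb Q^n$, $k\in\mathbb Q$; a rational affine space is an intersection of rational hyperplanes ($\mathbb R^n$ itself being the empty intersection). For $x\in\mathbb R^n$, $F_x$ is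 the intersection of all rational hyperplanes of $\mathbb R^n$ containing $x$ (with $F_x=\mathbb R^n$ if there are none). For an $e$-dimensional rational affine space $F\subseteq\mathbb R^n$ ($0\le e\le n$), $c_F$ is the smallest possible denominator of a vertex of a regular $n$-simplex $\operatorname{conv}(v_0,\ldots,v_n)\subseteq\mathbb R^n$ with $v_0,\ldots,v_e\in F$ (the minimum is over all such simplexes and all of their vertices). Put $c_x=c_{F_x}$. Here $n=2$. *)

(* Defs.v *)
From HB Require Import structures.
From mathcomp Require Import all_boot all_order all_algebra.
From mathcomp Require Import boolp classical_sets reals.

Set Implicit Arguments.
Unset Strict Implicit.
Unset Printing Implicit Defensive.

Import Order.TTheory GRing.Theory Num.Theory.
Local Open Scope classical_set_scope.
Local Open Scope ring_scope.

(* Points of R^n are column vectors, so that an affine map reads x |-> U x + t. *)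

(* The least element of A; the junk value 0 is only reached when A is empty. *)
Definition min_nat (A : set nat) : nat :=
  xget 0%N [set d | A d /\ forall d', A d' -> (d <= d')%N].

Section FreeAbelian.
Variable V : zmodType.

Definition is_Zbasis (G : set V) (k : nat) (b : 'I_k -> V) : Prop :=
  (forall a : 'I_k -> int, \sum_(i < k) b i *~ a i = 0 -> forall i, a i = 0)
  /\ G = [set g | exists a : 'I_k -> int, g = \sum_(i < k) b i *~ a i].

Definition has_rank (G : set V) (k : nat) : Prop :=
  exists b : 'I_k -> V, is_Zbasis G b.

End FreeAbelian.

Section AffineGeometry.
Variable R : realType.

Definition affine_group (n : nat) : set ('cV[R]_n -> 'cV[R]_n) :=
  [set g | exists (U : 'M[int]_n) (t : 'cV[int]_n),
     (\det U = 1 \/ \det U = -1) /\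
     g = (fun x => map_mx intr U *m x + map_mx intr t)].

Definition orb (n : nat) (x : 'cV[R]_n) : set 'cV[R]_n :=
  [set y | exists2 g, affine_group g & y = g x].

Definition Ggroup (n : nat) (x : 'cV[R]_n) : set R :=
  [set g | exists (m : int) (a : 'I_n -> int),
     g = m%:~R + \sum_(i < n) (a i)%:~R * x i 0].

Definition rational_point (n : nat) (y : 'cV[R]_n) : Prop :=
  forall i, exists q : rat, y i 0 = ratr q.

Definition den (n : nat) (y : 'cV[R]_n) : nat :=
  min_nat [set d | (0 < d)%N /\ forall i, d%:R * y i 0 \is a Num.int].

(* Z^m, seen inside R^m. *)
Definition Zlattice (m : nat) : set 'cV[R]_m :=
  [set u | forall i, u i 0 \is a Num.int].

Definition homog (n : nat) (y : 'cV[R]_n) : 'cV[R]_(n + 1) :=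
  (den y)%:R *: col_mx y 1%:M.

Definition affinely_independent (n k : nat) (v : 'I_k.+1 -> 'cV[R]_n) : Prop :=
  \rank (\matrix_(i < n, j < k) (v (lift ord0 j) i 0 - v ord0 i 0)) = k.

Definition regular_simplex (n k : nat) (v : 'I_k.+1 -> 'cV[R]_n) : Prop :=
  [/\ affinely_independent v,
      forall i, rational_point (v i)
    & exists b : 'I_(n + 1) -> 'cV[R]_(n + 1),
        is_Zbasis (@Zlattice (n + 1)) b /\
        forall i, exists j, homog (v i) = b j].

Definition rational_hyperplane (n : nat) (H : set 'cV[R]_n) : Prop :=
  exists (h : 'cV[rat]_n) (k : rat),
    h != 0 /\ H = [set z | \sum_(i < n) ratr (h i 0) * z i 0 = ratr k].

Definition Fspace (n : nat) (x : 'cV[R]_n) : set 'cV[R]_n :=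
  \bigcap_(H in [set H | rational_hyperplane H /\ H x]) H.

Definition affine_dim (n : nat) (F : set 'cV[R]_n) (e : nat) : Prop :=
  exists (p : 'cV[R]_n) (B : 'M[R]_(n, e)),
    \rank B = e /\ F = [set z | exists a : 'cV[R]_e, z = p + B *m a].

(* The dimension e is determined by F, which is meant to be a (nonempty)
   rational affine space. *)
Definition c_aff (n : nat) (F : set 'cV[R]_n) : nat :=
  min_nat [set d | exists (e : nat) (v : 'I_n.+1 -> 'cV[R]_n),
    [/\ affine_dim F e,
        regular_simplex v,
        forall i : 'I_n.+1, (i <= e)%N -> F (v i)
      & exists i, d = den (v i)]].

Definition c_pt (n : nat) (x : 'cV[R]_n) : nat := c_aff (Fspace x).

End AffineGeometry.

(* Main.v *)
Require Import Defs.
From mathcomp Require Import all_boot all_order all_algebra.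
From mathcomp Require Import boolp classical_sets reals.
From mathcomp Require Import ring zify.

Set Implicit Arguments.
Unset Strict Implicit.
Unset Printing Implicit Defensive.

Import Order.TTheory GRing.Theory Num.Theory.
Local Open Scope classical_set_scope.
Local Open Scope ring_scope.

(** Both [Ggroup] and [c_pt] are invariant under integral affine
    transformations (lemmas [Ggroup_orb], [c_pt_affine]): such a transformation
    carries rational hyperplanes, denominators and regular simplexes to objects
    of the same kind.  The work is to recover the orbit from the two invariants.

    When [Ggroup x] has rank 2, the numbers 1, x_1, x_2 satisfy exactly one
    rational linear relation up to a scalar.  Taking the primitive multiple of
    the coefficients of x_1, x_2 as the first row of a unimodular matrix puts x
    in the normal form (r, y), with r rational and y irrational
    ([rank2_normal_form]).  For such a point the space F_x is the line
    z_1 = r ([Fspace_normal]).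

    Write r = p / d in lowest terms.  The integer points (a, b, c) with
    d a = p c are the homogeneous points over that line.  A rational point of
    the line has a denominator divisible by d.  In a regular triangle with an
    edge on the line, the form d a - p c takes a value of absolute value 1 at
    the homogeneous correspondent of the opposite vertex, so the denominator q
    of that vertex satisfies q p = 1 or q p = -1 modulo d
    ([den_vertex_opposite]); conversely each such q > 0 occurs
    ([regular_simplex_normal]).  One of these q is at most d, hence c_x is the
    least of them ([c_pt_normal]), and c_x determines p modulo d up to sign
    ([numq_congr]).

    The group G_x = Z + Z r + Z y determines d, because r lies in
    Z + Z r' + Z y' only without a y'-component ([denq_dvd_Ggroup]).  So two
    points (r, y), (r', y') with equal invariants satisfy r' = e r + k with
    e = 1 or e = -1 and k an integer.  Writing y' in terms of 1, r, y and y in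
    terms of 1, r', y' shows that y' = a r + b y + m with b = 1 or b = -1,
    which is an integral affine transformation ([orb_normal]). *)

(** * Least elements of sets of naturals *)

Lemma min_natP (A : set nat) :
  (exists d, A d) -> A (min_nat A) /\ forall d, A d -> (min_nat A <= d)%N.
Proof.
move=> exA; rewrite /min_nat.
have exA' : exists d, `[< A d >] by case: exA => d Ad; exists d; apply/asboolP.
apply: (@xgetPex _ 0%N [set d | A d /\ forall d', A d' -> (d <= d')%N]).
case: (ex_minnP exA') => m /asboolP Am lem; exists m; split=> // d' Ad'.
by apply: lem; apply/asboolP.
Qed.

Lemma min_nat_unique (A : set nat) d :
  A d -> (forall d', A d' -> (d <= d')%N) -> min_nat A = d.
Proof.
move=> Ad le_d; have [Am le_m] := min_natP (ex_intro _ d Ad).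
by apply/eqP; rewrite eqn_leq le_m // le_d.
Qed.

(** This is how [c_pt] gets computed: the denominators of a special family of
    vertices have the same minimum as those of all vertices, once every vertex
    dominates one of the family. *)
Lemma eq_min_nat (A B : set nat) :
  B `<=` A -> (forall a, A a -> exists2 b, B b & (b <= a)%N) ->
  min_nat A = min_nat B.
Proof.
move=> subBA coB; rewrite /min_nat; congr (xget 0%N _); apply/seteqP.
split=> [d [Ad le_d]|d [Bd le_d]] /=; split.
- have [b Bb le_bd] := coB _ Ad.
  by have -> : d = b by apply/eqP; rewrite eqn_leq le_bd le_d //; apply: subBA.
- by move=> b /subBA /le_d.
- exact: subBA.
- by move=> a /coB [b /le_d le_db le_ba]; apply: leq_trans le_ba.
Qed.

(** * Invariance under integral affine transformations *)

Lemma is_Zbasis_unimodular (R : realType) (m k : nat) (A B : 'M[int]_m)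
    (b : 'I_k -> 'cV[R]_m) : A *m B = 1%:M -> B *m A = 1%:M ->
  is_Zbasis (@Zlattice R m) b ->
  is_Zbasis (@Zlattice R m) (fun i => map_mx intr A *m b i).
Proof.
move=> AB BA [free_b span_b].
have mulsum (M : 'M[int]_m) (c : 'I_k -> 'cV[R]_m) (a : 'I_k -> int) :
    \sum_(i < k) (map_mx intr M *m c i) *~ a i
    = map_mx intr M *m \sum_(i < k) c i *~ a i.
  by rewrite mulmx_sumr; apply: eq_bigr => i _; rewrite raddfMz.
have Zmul (M : 'M[int]_m) u : Zlattice u ->
    Zlattice (map_mx (intr : int -> R) M *m u).
  move=> Zu i; rewrite mxE rpred_sum // => j _.
  by rewrite mxE rpredM // intr_int.
have mapAB : map_mx (intr : int -> R) A *m map_mx intr B = 1%:M.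
  by rewrite -map_mxM AB map_mx1.
have mapBA : map_mx (intr : int -> R) B *m map_mx intr A = 1%:M.
  by rewrite -map_mxM BA map_mx1.
split=> [a|].
  rewrite mulsum => /(congr1 (mulmx (map_mx intr B))).
  by rewrite mulmxA mapBA mul1mx mulmx0; apply: free_b.
apply/seteqP; split=> [u Zu|_ [a ->]] /=.
  have : Zlattice (map_mx intr B *m u) by exact: Zmul.
  rewrite span_b => -[a uE]; exists a.
  by rewrite mulsum -uE mulmxA mapAB mul1mx.
by rewrite mulsum; apply: Zmul; rewrite span_b; exists a.
Qed.

Section AffineInvariance.
Variables (R : realType) (n : nat).
Implicit Types (g h : 'cV[R]_n -> 'cV[R]_n) (x y z : 'cV[R]_n).

Lemma map_mxKunit (U : 'M[int]_n) : \det U = 1 \/ \det U = -1 ->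
  map_mx (intr : int -> R) U *m map_mx intr (invmx U) = 1%:M /\
  map_mx (intr : int -> R) (invmx U) *m map_mx intr U = 1%:M.
Proof.
move=> dU; have uU : U \in unitmx by rewrite unitmxE; case: dU => ->.
by rewrite -!map_mxM mulmxV // mulVmx // map_mx1.
Qed.

Lemma affine_group_inv g : affine_group g ->
  exists2 h, affine_group h & cancel g h /\ cancel h g.
Proof.
move=> [U [t [dU ->]]]; have [UV VU] := map_mxKunit dU.
exists (fun x => map_mx intr (invmx U) *m x + map_mx intr (- (invmx U *m t))).
  exists (invmx U), (- (invmx U *m t)); split=> //.
  by rewrite det_inv; case: dU => ->; [left | right].
rewrite map_mxN map_mxM; split=> x.
  by rewrite mulmxDr mulmxA VU mul1mx addrK.
by rewrite mulmxBr !mulmxA UV !mul1mx subrK.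
Qed.

Lemma affine_group_comp g h :
  affine_group g -> affine_group h -> affine_group (g \o h).
Proof.
move=> [U [t [dU ->]]] [V [s [dV ->]]].
exists (U *m V), (U *m s + t); split.
  by rewrite det_mulmx; case: dU => ->; case: dV => ->;
     rewrite ?mulr1 ?mul1r ?mulN1r ?opprK; tauto.
by apply/funext=> x /=; rewrite map_mxD !map_mxM mulmxDr mulmxA addrA.
Qed.

Lemma orb_sym x y : orb x y -> orb y x.
Proof.
by move=> [g /affine_group_inv[h hh [gK _]] ->]; exists h => //; rewrite gK.
Qed.

Lemma orb_trans y x z : orb x y -> orb y z -> orb x z.
Proof.
move=> [g gg ->] [h hh ->]; exists (h \o g) => //; exact: affine_group_comp.
Qed.

(** The coordinates of an integral affine image are integral combinations of
    1 and the old coordinates; invertibility then gives equality on orbits. *)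
Lemma Ggroup_affine_sub g x : affine_group g -> Ggroup (g x) `<=` Ggroup x.
Proof.
move=> [U [t [_ ->]]] _ [m [a ->]].
exists (m + \sum_i a i * t i 0), (fun j => \sum_i a i * U i j).
rewrite rmorphD /= -addrA; congr (_ + _).
rewrite (eq_bigr (fun i => \sum_j (a i * U i j)%:~R * x j 0 + (a i * t i 0)%:~R));
  last first.
  move=> i _; rewrite !mxE mulrDr mulr_sumr intrM; congr (_ + _).
  by apply: eq_bigr => j _; rewrite mxE intrM mulrA.
rewrite big_split /= addrC rmorph_sum /= exchange_big /=; congr (_ + _).
by apply: eq_bigr => j _; rewrite -mulr_suml rmorph_sum.
Qed.

Lemma Ggroup_orb x y : orb x y -> Ggroup y = Ggroup x.
Proof.
move=> [g gg ->]; apply/seteqP; split; first exact: Ggroup_affine_sub.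
have [k kk [gK _]] := affine_group_inv gg.
by rewrite -{1}(gK x); apply: Ggroup_affine_sub.
Qed.

Lemma integral_affine g (d : nat) y : affine_group g ->
  (forall i, d%:R * y i 0 \is a Num.int) ->
  forall i, d%:R * g y i 0 \is a Num.int.
Proof.
move=> [U [t [_ ->]]] dy i; rewrite !mxE mulrDr mulr_sumr rpredD //.
  by apply: rpred_sum => j _; rewrite mxE mulrCA rpredM // intr_int.
by rewrite rpredM ?intr_int // natr_int.
Qed.

Lemma den_affine g y : affine_group g -> den (g y) = den y.
Proof.
move=> gg; have [h hh [gK _]] := affine_group_inv gg.
rewrite /den; congr min_nat; apply/seteqP; split=> d [d0 dy]; split=> //.
  by rewrite -(gK y); apply: integral_affine.
exact: integral_affine.
Qed.

Lemma rational_point_affine g y :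
  affine_group g -> rational_point y -> rational_point (g y).
Proof.
move=> [U [t [_ ->]]] /choice[q yq] i.
exists (\sum_j (U i j)%:~R * q j + (t i 0)%:~R).
rewrite !mxE rmorphD rmorph_sum /= ratr_int; congr (_ + _).
by apply: eq_bigr => j _; rewrite mxE rmorphM /= ratr_int yq.
Qed.

(** In homogeneous coordinates the affine map is linear, with the unimodular
    block matrix [U t; 0 1].  Invertibility is recorded by an explicit two-sided
    inverse, which survives the passage from integer to real matrices. *)
Lemma homog_affine g : affine_group g ->
  exists A B : 'M[int]_(n + 1), A *m B = 1%:M /\ B *m A = 1%:M /\
    forall y, homog (g y) = map_mx intr A *m homog y.
Proof.
move=> gg; have [U [t [dU gE]]] := gg.
pose A : 'M[int]_(n + 1) := block_mx U t 0 1%:M.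
have uA : A \in unitmx.
  by rewrite unitmxE det_ublock det1 mulr1; case: dU => ->.
exists A, (invmx A); rewrite mulmxV // mulVmx //; split=> //; split=> // y.
rewrite /homog den_affine // -scalemxAr map_block_mx mul_block_col.
by rewrite map_mx0 map_mx1 mul0mx add0r !mulmx1 gE.
Qed.

Lemma regular_simplex_affine g k (v : 'I_k.+1 -> 'cV[R]_n) :
  affine_group g -> regular_simplex v -> regular_simplex (g \o v).
Proof.
move=> gg [indep_v rat_v [b [basis_b bv]]]; split.
- have [U [t [dU gE]]] := gg; have [UV _] := map_mxKunit dU.
  rewrite /affinely_independent -[RHS]indep_v; set M := (X in _ = \rank X).
  have -> : \matrix_(i, j) ((g \o v) (lift ord0 j) i 0 - (g \o v) ord0 i 0)
            = map_mx intr U *m M.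
    apply/matrixP=> i j; rewrite gE !mxE opprD addrACA subrr addr0.
    by rewrite -sumrB; apply: eq_bigr => l _; rewrite !mxE mulrBr.
  rewrite eqmxMfull // row_full_unit.
  by have [] := mulmx1_unit UV.
- by move=> i; apply: rational_point_affine.
- have [A [B [AB [BA homog_g]]]] := homog_affine gg.
  exists (fun i => map_mx intr A *m b i); split.
    exact: is_Zbasis_unimodular AB BA basis_b.
  by move=> i; have [j vij] := bv i; exists j; rewrite -vij -homog_g.
Qed.

(** A rational hyperplane pulls back along the map to a rational hyperplane,
    with normal vector [U^T h]. *)
Lemma Fspace_affine g x z :
  affine_group g -> Fspace x z -> Fspace (g x) (g z).
Proof.
move=> [U [t [dU gE]]] Fxz _ [[h [k [h0 ->]]] /= xH].
have [uU|] := boolP (U \in unitmx); last by rewrite unitmxE; case: dU => ->.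
pose h' := (map_mx intr U)^T *m h : 'cV[rat]_n.
pose k' := k - \sum_i h i 0 * (t i 0)%:~R.
have pull y : \sum_i ratr (h i 0) * g y i 0 - ratr k
    = \sum_i ratr (h' i 0) * y i 0 - ratr k' :> R.
  rewrite /k' rmorphB rmorph_sum /= opprB addrA; congr (_ - _).
  rewrite (eq_bigr (fun i => \sum_j ratr (h i 0) * (U i j)%:~R * y j 0
     + ratr (h i 0) * (t i 0)%:~R)); last first.
    move=> i _; rewrite gE !mxE mulrDr mulr_sumr; congr (_ + _).
    by apply: eq_bigr => j _; rewrite mxE mulrA.
  rewrite big_split exchange_big /=; congr (_ + _); apply: eq_bigr => j _.
    rewrite -mulr_suml !mxE rmorph_sum /=; congr (_ * _).
    by apply: eq_bigr => i _; rewrite !mxE rmorphM /= ratr_int mulrC.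
  by rewrite rmorphM /= ratr_int.
have h'0 : h' != 0.
  apply: contra h0 => /eqP /(congr1 (mulmx (map_mx intr (invmx U))^T)).
  rewrite mulmxA -trmx_mul -map_mxM mulmxV // map_mx1 trmx1 mul1mx mulmx0.
  by move=> ->.
apply/eqP; rewrite -subr_eq0 pull subr_eq0; apply/eqP.
apply: (Fxz [set z | \sum_i ratr (h' i 0) * z i 0 = ratr k']).
split; first by exists h', k'.
by apply/eqP; rewrite -subr_eq0 -pull subr_eq0 xH.
Qed.

Lemma affine_dim_affine g x e : affine_group g ->
  affine_dim (Fspace x) e -> affine_dim (Fspace (g x)) e.
Proof.
move=> gg [p [B [rkB FE]]].
have [h hh [gK hK]] := affine_group_inv gg.
have [U [t [dU gE]]] := gg; have [UV _] := map_mxKunit dU.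
exists (g p), (map_mx intr U *m B); split.
  rewrite -[RHS]rkB eqmxMfull // row_full_unit.
  by have [] := mulmx1_unit UV.
have gpE a : g (p + B *m a) = g p + map_mx intr U *m B *m a.
  by rewrite gE mulmxDr mulmxA addrAC.
apply/seteqP; split=> [z Fz|_ [a ->]] /=.
  have : Fspace x (h z) by rewrite -(gK x); apply: Fspace_affine.
  by rewrite FE => -[a hz]; exists a; rewrite -gpE -hz hK.
by rewrite -gpE; apply: Fspace_affine => //; rewrite FE; exists a.
Qed.

(** The denominators competing for the minimum are the same for [x] and [g x]:
    one inclusion is transport along [g], the other along its inverse. *)
Lemma c_pt_affine g x : affine_group g -> c_pt (g x) = c_pt x.
Proof.
pose C y := [set d | exists (e : nat) (v : 'I_n.+1 -> 'cV[R]_n),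
    [/\ affine_dim (Fspace y) e, regular_simplex v,
        forall i : 'I_n.+1, (i <= e)%N -> Fspace y (v i)
      & exists i, d = den (v i)]].
have subC h y : affine_group h -> C y `<=` C (h y).
  move=> hh d [e [v [dimF reg_v Fv [i ->]]]]; exists e, (h \o v); split.
  - exact: affine_dim_affine.
  - exact: regular_simplex_affine.
  - by move=> j /Fv; apply: Fspace_affine.
  - by exists i; rewrite /= den_affine.
move=> gg; have [h hh [gK _]] := affine_group_inv gg.
have -> : c_pt x = min_nat (C x) by [].
have -> : c_pt (g x) = min_nat (C (g x)) by [].
congr min_nat; apply/seteqP; split; last exact: subC.
by have := subC h (g x) hh; rewrite gK.
Qed.

End AffineInvariance.

(** * Points of the plane and the rational normal form *)

Section Plane.
Variable R : realType.

Definition pt2 (T : Type) (a b : T) : 'cV[T]_2 :=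
  \col_i (if i == 0 then a else b).

Lemma pt2E (T : Type) (x : 'cV[T]_2) : x = pt2 (x 0 0) (x 1 0).
Proof.
apply/colP=> i; rewrite mxE; case: i => [[|[|//]] lti] /=;
  by congr (x _ _); apply: val_inj.
Qed.

Lemma sum_ord2 (V : nmodType) (F : 'I_2 -> V) : \sum_i F i = F 0 + F 1.
Proof.
by rewrite !big_ord_recl big_ord0 addr0; congr (_ + F _); apply: val_inj.
Qed.

Lemma det2 (S : comNzRingType) (A : 'M[S]_2) :
  \det A = A 0 0 * A 1 1 - A 0 1 * A 1 0.
Proof.
rewrite (expand_det_row _ 0) sum_ord2 /cofactor !det_mx11 !mxE /=.
rewrite addn0 expr0 expr1 mul1r mulN1r mulrN.
by congr (_ * A _ _ - _ * A _ _); apply: val_inj.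
Qed.

Lemma orb_pt2 (u v : R) (a b c d s t : int) :
  a * d - b * c = 1 \/ a * d - b * c = -1 ->
  orb (pt2 u v) (pt2 (a%:~R * u + b%:~R * v + s%:~R)
                     (c%:~R * u + d%:~R * v + t%:~R)).
Proof.
move=> det_abcd.
pose U : 'M[int]_2 :=
  \matrix_(i, j) (if i == 0 then pt2 a b j 0 else pt2 c d j 0).
exists (fun x => map_mx intr U *m x + map_mx intr (pt2 s t)).
  by exists U, (pt2 s t); rewrite det2 !mxE.
by rewrite [RHS]pt2E !mxE !sum_ord2 !mxE.
Qed.

Lemma Ggroup_pt2 (u v g : R) : Ggroup (pt2 u v) g <->
  exists m a b : int, g = m%:~R + a%:~R * u + b%:~R * v.
Proof.
split=> [[m [a ->]]|[m [a [b ->]]]].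
  by exists m, (a 0), (a 1); rewrite sum_ord2 !mxE addrA.
by exists m, (fun i => if i == 0 then a else b); rewrite sum_ord2 !mxE addrA.
Qed.

Lemma denq_mul_ratr (r : rat) : (denq r)%:~R * ratr r = (numq r)%:~R :> R.
Proof.
by rewrite -{2}(divq_num_den r) fmorph_div /= !ratr_int mulrC divfK //
           intr_eq0 denq_neq0.
Qed.

(** With r = p / d in lowest terms, if q r is an integer then d divides q p,
    and p is coprime to d. *)
Lemma denq_dvd (r : rat) (q : int) :
  (q%:~R * ratr r : R) \is a Num.int -> (denq r %| q)%Z.
Proof.
move=> /intrP[m qr].
have : (q * numq r)%:~R = (m * denq r)%:~R :> R.
  by rewrite !intrM -qr mulrAC -mulrA denq_mul_ratr.
move=> /intr_inj E.
rewrite -(@Gauss_dvdzl _ _ (numq r)).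
  by rewrite E dvdz_mull.
by rewrite coprimezE coprime_sym coprime_num_den.
Qed.

(** A common denominator would make the two elements of a basis rationally
    dependent.  This is what forces an irrational coordinate. *)
Lemma not_bounded_denominators (G : set R) (N : int) : has_rank G 2 -> N != 0 ->
  ~ (forall g, G g -> exists m : int, N%:~R * g = m%:~R).
Proof.
move=> [b [free_b GE]] N0 bdG.
have N0' : N%:~R != 0 :> R by rewrite intr_eq0.
have Gb i : G (b i).
  rewrite GE; exists (fun j => (j == i)%:Z).
  rewrite (bigD1 i) //= eqxx big1 ?addr0 // => j /negPf ->.
  by rewrite mulr0z.
have [m0 E0] := bdG _ (Gb 0); have [m1 E1] := bdG _ (Gb 1).
have free2 (a c : int) : b 0 *~ a + b 1 *~ c = 0 -> a = 0 /\ c = 0.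
  move=> ac; pose f := fun i : 'I_2 => if i == 0 then a else c.
  have := free_b f; rewrite sum_ord2 => /(_ ac) f0.
  by split; [exact: (f0 0) | exact: (f0 1)].
have [m10 /eqP] : m1 = 0 /\ - m0 = 0.
  apply: free2; apply: (mulfI N0').
  rewrite -(mulrzr (b 0)) -(mulrzr (b 1)) rmorphN /=.
  transitivity (m1%:~R * (N%:~R * b 0) - m0%:~R * (N%:~R * b 1)); first by ring.
  by rewrite E0 E1; ring.
rewrite oppr_eq0 => /eqP m00.
have b0 : b 0 = 0.
  by apply: (mulfI N0'); rewrite E0 m00 mulr0.
have [] // : (1 : int) = 0 /\ (0 : int) = 0.
by apply: free2; rewrite b0 mul0rz mulr0z addr0.
Qed.

(** Expressed in a basis of the group, 1, x, y become three vectors of Z^2; by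
    Cramer's rule they satisfy the relation whose coefficients are their 2 x 2
    minors. *)
Lemma rank2_relation (x y : R) : has_rank (Ggroup (pt2 x y)) 2 ->
  exists k0 k1 k2 : int, (k1 != 0) || (k2 != 0) /\
    k1%:~R * x + k2%:~R * y = k0%:~R.
Proof.
move=> [b [_ GE]].
have coords m a c : exists s t : int,
    m%:~R + a%:~R * x + c%:~R * y = s%:~R * b 0 + t%:~R * b 1.
  have : Ggroup (pt2 x y) (m%:~R + a%:~R * x + c%:~R * y).
    by apply/Ggroup_pt2; exists m, a, c.
  rewrite GE => -[s ->]; exists (s 0), (s 1).
  by rewrite sum_ord2 !mulrzl.
have [a0 [a1]] := coords 1 0 0; rewrite !mul0r !addr0 => Ea.
have [b0 [b1]] := coords 0 1 0; rewrite mul0r mul1r add0r addr0 => Eb.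
have [c0 [c1]] := coords 0 0 1; rewrite mul0r mul1r add0r add0r => Ec.
have [ca|/negPf ca] :=
  boolP ((c0 * a1 - c1 * a0 != 0) || (a0 * b1 - a1 * b0 != 0)).
  exists (c0 * b1 - c1 * b0), (c0 * a1 - c1 * a0), (a0 * b1 - a1 * b0).
  split=> //.
  transitivity ((c0 * b1 - c1 * b0)%:~R * 1%:~R : R); last by rewrite mulr1.
  by rewrite Ea Eb Ec; ring.
move: ca => /negbT; rewrite negb_or !negbK => /andP[/eqP ca /eqP ab].
(* Both minors vanish: x is then proportional to 1, with a ratio that can be
   read off from any nonzero coordinate of 1. *)
have [a00|a00] := eqVneq a0 0.
  have a10 : a1 != 0.
    apply/eqP=> a10; move: Ea; rewrite a00 a10 !mul0r addr0 => /eqP.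
    by rewrite intr_eq0.
  exists b1, a1, 0; rewrite a10; split=> //.
  transitivity (b1%:~R * 1%:~R : R); last by rewrite mulr1.
  rewrite mul0r addr0 Ea Eb.
  have {}ab : (a1%:~R * b0%:~R : R) = a0%:~R * b1%:~R.
    by rewrite -!intrM; congr intr; apply/esym/eqP; rewrite -subr_eq0 ab.
  by rewrite !mulrDr !mulrA ab; ring.
exists b0, a0, 0; rewrite a00; split=> //.
transitivity (b0%:~R * 1%:~R : R); last by rewrite mulr1.
rewrite mul0r addr0 Ea Eb.
have {}ab : (a0%:~R * b1%:~R : R) = a1%:~R * b0%:~R.
  by rewrite -!intrM; congr intr; apply/eqP; rewrite -subr_eq0 ab.
by rewrite !mulrDr !mulrA ab; ring.
Qed.

Definition irrational (y : R) := forall q : rat, y <> ratr q.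

(** Dividing the relation by the gcd g of its coefficients gives a primitive
    row (l1, l2), which the Bezout coefficients complete to the unimodular
    matrix with rows (l1, l2) and (-t, s).  Its first output is k0 / g. *)
Lemma rank2_normal_form (x : 'cV[R]_2) : has_rank (Ggroup x) 2 ->
  exists (r : rat) (y : R), irrational y /\ orb x (pt2 (ratr r) y).
Proof.
rewrite (pt2E x); move: (x 0 0) (x 1 0) => {x} u v rkG.
have [k0 [k1 [k2 [k12 rel]]]] := rank2_relation rkG.
have [s [t st]] := Bezoutz k1 k2.
have g0 : gcdz k1 k2 != 0 by rewrite gcdz_eq0 negb_and.
have [[l1 k1E] [l2 k2E]] := (dvdzP (dvdz_gcdl k1 k2), dvdzP (dvdz_gcdr k1 k2)).
set g := gcdz k1 k2 in st g0 k1E k2E.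
have stl : s * l1 + t * l2 = 1.
  by apply: (mulIf g0); rewrite mul1r -[RHS]st k1E k2E; ring.
have gR : g%:~R != 0 :> R by rewrite intr_eq0.
pose r : rat := k0%:~R / g%:~R.
have rE : l1%:~R * u + l2%:~R * v = ratr r :> R.
  apply: (mulfI gR); rewrite fmorph_div /= !ratr_int mulrC [RHS]mulrC divfK //.
  by rewrite -rel k1E k2E !intrM; ring.
have orbx : orb (pt2 u v) (pt2 (ratr r) ((- t)%:~R * u + s%:~R * v)).
  have := @orb_pt2 u v l1 l2 (- t) s 0 0; rewrite !addr0 rE; apply.
  by left; rewrite -stl; ring.
clearbody r; exists r, ((- t)%:~R * u + s%:~R * v); split=> // q yq.
rewrite yq in orbx.
move: rkG; rewrite -(Ggroup_orb orbx) => rkG.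
apply: (not_bounded_denominators (N := denq r * denq q) rkG).
  by rewrite mulf_neq0 ?denq_neq0.
move=> _ /Ggroup_pt2[m [a [b ->]]].
exists (m * denq r * denq q + a * denq q * numq r + b * denq r * numq q).
by rewrite !rmorphD !rmorphM /= -!denq_mul_ratr; ring.
Qed.

(** A rational hyperplane through (r, y) has no second normal component, or
    y would be rational. *)
Lemma Fspace_normal (r : rat) (y : R) : irrational y ->
  Fspace (pt2 (ratr r) y) = [set z | z 0 0 = ratr r].
Proof.
move=> irr_y; apply/seteqP; split=> [z Fz|z zr] /=.
  pose h : 'cV[rat]_2 := pt2 1 0.
  have hE (w : 'cV[R]_2) : \sum_i ratr (h i 0) * w i 0 = w 0 0.
    by rewrite sum_ord2 !mxE rmorph1 rmorph0 mul1r mul0r addr0.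
  have : [set w : 'cV[R]_2 | \sum_i ratr (h i 0) * w i 0 = ratr r] z.
    apply: Fz; split; last by rewrite /= hE mxE.
    exists h, r; split=> //; apply/eqP=> /colP/(_ 0).
    by rewrite !mxE => /eqP; rewrite oner_eq0.
  by rewrite /= hE.
move=> _ [[h [k [h0 ->]]] /=]; rewrite !sum_ord2 !mxE /= zr => hk.
have h10 : h 1 0 = 0.
  apply/eqP/negPn/negP=> h10; apply: (irr_y ((k - h 0 0 * r) / h 1 0)).
  have h10R : ratr (h 1 0) != 0 :> R by rewrite fmorph_eq0.
  apply: (mulfI h10R); rewrite fmorph_div /= mulrC [RHS]mulrC divfK //.
  by rewrite rmorphB rmorphM /= -hk; ring.
by rewrite -hk h10 rmorph0 !mul0r.
Qed.

End Plane.

(** * Vertices of regular triangles with an edge on the line z_1 = r *)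

Section SimplexVertices.
Variables (R : realType) (n : nat).

Lemma rational_denP (y : 'cV[R]_n) : rational_point y ->
  (0 < den y)%N /\ forall i, (den y)%:R * y i 0 \is a Num.int.
Proof.
move=> /choice[q yq]; pose D := (\prod_i `|denq (q i)|)%N.
suff /min_natP[//] : exists d : nat,
  (0 < d)%N /\ forall i, d%:R * y i 0 \is a Num.int.
exists D; split; first by apply: prodn_gt0 => i; rewrite absz_gt0 denq_neq0.
move=> i; rewrite /D (bigD1 i) //= natrM mulrAC rpredM ?natr_int // yq.
rewrite natr_absz gtr0_norm ?denq_gt0 //.
by rewrite denq_mul_ratr intr_int.
Qed.

Lemma homog_inj (y z : 'cV[R]_n) :
  rational_point y -> homog y = homog z -> y = z.
Proof.
move=> /rational_denP[d0 _]; rewrite /homog !scale_col_mx => /eq_col_mx[yz].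
move=> /matrixP/(_ 0 0); rewrite !mxE !mulr1 => /eqP.
rewrite eqr_nat => /eqP dyz; move: yz; rewrite -dyz.
by apply: scalerI; rewrite pnatr_eq0 -lt0n.
Qed.

(** Two equal vertices would give a nontrivial relation between the columns
    v_j - v_0, namely a difference of indicator vectors. *)
Lemma affinely_independent_inj k (v : 'I_k.+1 -> 'cV[R]_n) :
  affinely_independent v -> injective v.
Proof.
rewrite /affinely_independent; set M := (X in \rank X); move=> rkM i i' vii'.
have freeM : row_free M^T by rewrite /row_free mxrank_tr rkM.
have pick (F : 'I_k.+1 -> R) h :
    \sum_j (lift ord0 j == h)%:R * (F (lift ord0 j) - F ord0) = F h - F ord0.
  case: (unliftP ord0 h) => [j|] ->.
    rewrite (bigD1 j) //= eqxx mul1r big1 ?addr0 // => l lj.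
    by rewrite (inj_eq lift_inj) (negPf lj) mul0r.
  by rewrite subrr big1 // => j _; rewrite eq_sym (negPf (neq_lift _ _)) mul0r.
pose c : 'rV[R]_k := \row_j ((lift ord0 j == i)%:R - (lift ord0 j == i')%:R).
have : c = 0.
  apply: (row_free_inj freeM); rewrite mul0mx; apply/rowP=> l; rewrite !mxE.
  under eq_bigr => j _ do rewrite !mxE mulrBl.
  by rewrite sumrB !(pick (fun h => v h l 0)) vii' subrr.
move=> /rowP c0.
have {c0} same j : (lift ord0 j == i) = (lift ord0 j == i').
  move: (c0 j); rewrite !mxE => /eqP; rewrite subr_eq0 eqr_nat => /eqP.
  by case: (_ == i); case: (_ == i').
case: (unliftP ord0 i) same => [j ->|-> same].
  by move=> /(_ j); rewrite eqxx => /esym/eqP.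
case: (unliftP ord0 i') same => [j ->|-> //].
by move=> /(_ j); rewrite eqxx eq_sym (negPf (neq_lift _ _)).
Qed.

End SimplexVertices.

Section NormalFormInvariant.
Variable R : realType.

(** Writing r = p / d in lowest terms, these are the positive q that are
    inverse to p or to -p modulo d. *)
Definition inverse_dens (r : rat) : set nat := [set q | (0 < q)%N /\
  exists s : int, s * denq r - q%:Z * numq r = 1
               \/ s * denq r - q%:Z * numq r = -1].

(** The residue modulo d of a Bezout coefficient is an inverse of p below d;
    if it is 0 then d = 1 and q = d works. *)
Lemma inverse_dens_le (r : rat) :
  exists2 q, inverse_dens r q & (q <= `|denq r|)%N.
Proof.
have : coprimez (numq r) (denq r) by rewrite coprimezE coprime_num_den.
move=> /coprimezP[[u v] /= uv].
have d0 := denq_gt0 r.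
have uE := divz_eq u (denq r); set k := (u %/ denq r)%Z in uE.
have [m0|m0] := eqVneq (u %% denq r)%Z 0.
  exists `|denq r|%N => //; split; first by rewrite absz_gt0 denq_neq0.
  exists (numq r + (k * numq r + v)); left; rewrite gtz0_abs //.
  by rewrite -uv [u in RHS]uE m0; ring.
have m_ge0 : 0 <= (u %% denq r)%Z by rewrite modz_ge0 // denq_neq0.
have m_lt : (u %% denq r)%Z < denq r by rewrite ltz_pmod.
move: (u %% denq r)%Z uE m0 m_ge0 m_lt => m uE m0 m_ge0 m_lt.
exists `|m|%N; last by lia.
split; first by rewrite absz_gt0.
exists (- (v + k * numq r)); right; rewrite gez0_abs //.
by rewrite -uv uE; ring.
Qed.

(** The integral form f (a, b, c) = d a - p c vanishes at the basis vectors over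
    the other two vertices and takes the value 1 at some integer point, since p
    and d are coprime.  Expanding that point in the basis, f must be invertible
    at the third vector. *)
Lemma den_vertex_opposite (r : rat) (v : 'I_3 -> 'cV[R]_2) (k : 'I_3) :
  regular_simplex v -> (forall i, i != k -> v i 0 0 = ratr r) ->
  inverse_dens r (den (v k)).
Proof.
move=> [indep_v rat_v [b [[_ span_b] /choice[j vj]]]] Fv.
pose f (u : 'cV[R]_(2 + 1)) : R :=
  u (lshift 1 0) 0 * (denq r)%:~R - u (rshift 2 0) 0 * (numq r)%:~R.
have entryMz (u : 'cV[R]_(2 + 1)) (z : int) i : (u *~ z) i 0 = u i 0 * z%:~R.
  by rewrite -scaler_int mxE mulrC.
have f_sum (a : 'I_(2 + 1) -> int) :
    f (\sum_i b i *~ a i) = \sum_i f (b i) * (a i)%:~R.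
  rewrite /f !summxE !mulr_suml -sumrB; apply: eq_bigr => i _.
  by rewrite !entryMz; ring.
have fv i :
    f (b (j i)) = (den (v i))%:R * (v i 0 0 * (denq r)%:~R - (numq r)%:~R).
  rewrite -vj /f /homog !mxE (unsplitK (inl _)) (unsplitK (inr _)) !mxE.
  by rewrite eqxx mulr1; ring.
have inj_j : injective j.
  move=> i i' jii'; apply: (affinely_independent_inj indep_v).
  by apply: homog_inj; [exact: rat_v | rewrite !vj jii'].
have : coprimez (numq r) (denq r) by rewrite coprimezE coprime_num_den.
move=> /coprimezP[[s t] /= st].
have : Zlattice (col_mx (pt2 t%:~R 0) (- s%:~R)%:M : 'cV[R]_(2 + 1)).
  move=> i; rewrite mxE; case: (split i) => l; rewrite mxE.
    by case: ifP; rewrite ?intr_int ?rpred0.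
  by rewrite ord1 eqxx mulr1n rpredN intr_int.
rewrite span_b => -[a /(congr1 f)]; rewrite f_sum.
rewrite (reindex_inj inj_j) (bigD1 k) //= big1 ?addr0; last first.
  move=> i ik; rewrite fv Fv // [ratr r * _]mulrC denq_mul_ratr subrr.
  by rewrite mulr0 mul0r.
have [d0 /(_ 0)/intrP[w vw]] := rational_denP (rat_v k).
rewrite fv mulrBr mulrA vw {1}/f !mxE (unsplitK (inl _)) (unsplitK (inr _)) !mxE /=.
rewrite mulr1n mulNr opprK -!intrM -intrD [t * _ + _]addrC st.
rewrite -[(den _)%:R]/((den _)%:Z%:~R) -!intrM -intrB -intrM.
move=> /intr_inj/esym E; split=> //; exists w.
have := congr1 absz E; rewrite abszM => /eqP.
rewrite muln_eq1 => /andP[/eqP wd _].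
by move: (_ - _) wd => e; lia.
Qed.

Lemma den_vertex_on_line (r : rat) (y : 'cV[R]_2) :
  rational_point y -> y 0 0 = ratr r -> (`|denq r| <= den y)%N.
Proof.
move=> /rational_denP[d0 /(_ 0)] + yr; rewrite yr => dr.
by have := @denq_dvd R r (den y) dr; rewrite dvdzE /=; apply: dvdn_leq.
Qed.

(** Integer points of R^3 in the block form used by [homog]. *)
Definition hvec (a b c : int) : 'cV[R]_(2 + 1) :=
  col_mx (pt2 a%:~R b%:~R) (c%:~R)%:M.

Lemma hvecMz a b c (z : int) : hvec a b c *~ z = hvec (a * z) (b * z) (c * z).
Proof.
rewrite -scaler_int /hvec scale_col_mx scale_scalar_mx -intrM [z * c]mulrC.
congr col_mx; apply/colP=> i; rewrite !mxE.
by case: ifP => _; rewrite -intrM mulrC.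
Qed.

Lemma hvecD a b c a' b' c' :
  hvec a b c + hvec a' b' c' = hvec (a + a') (b + b') (c + c').
Proof.
rewrite /hvec add_col_mx -raddfD -intrD; congr col_mx.
by apply/colP=> i; rewrite !mxE; case: ifP => _; rewrite intrD.
Qed.

Lemma hvec_inj a b c a' b' c' :
  hvec a b c = hvec a' b' c' -> [/\ a = a', b = b' & c = c'].
Proof.
move=> /eq_col_mx[ab /matrixP/(_ 0 0)]; rewrite !mxE => /intr_inj ->.
by move/colP: ab => ab; move: (ab 0) (ab 1);
  rewrite !mxE => /intr_inj -> /intr_inj ->.
Qed.

Lemma Zlattice_hvec u : Zlattice u <-> exists a b c, u = hvec a b c.
Proof.
split=> [Zu|[a [b [c ->]]] i].
  have [a ua] := intrP (Zu (lshift 1 0)); have [b ub] := intrP (Zu (lshift 1 1)).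
  have [c uc] := intrP (Zu (rshift 2 0)).
  exists a, b, c; rewrite -[u]vsubmxK /hvec [usubmx u]pt2E !mxE ua ub.
  by congr col_mx; apply/matrixP=> i l; rewrite !ord1 !mxE uc.
rewrite mxE; case: (split i) => l; rewrite mxE ?ord1 ?intr_int //.
by case: ifP; rewrite intr_int.
Qed.

(** The Bezout relation says that (a, b, q) is primitive, so it is the
    homogeneous correspondent of (a / q, b / q). *)
Lemma homog_pt2 (a b u v w : int) (q : nat) : (0 < q)%N ->
  u * a + v * b + w * q%:Z = 1 ->
  den (pt2 (a%:~R / q%:R) (b%:~R / q%:R) : 'cV[R]_2) = q /\
  homog (pt2 (a%:~R / q%:R) (b%:~R / q%:R)) = hvec a b q%:Z.
Proof.
move=> q0 uvw; have qR : q%:R != 0 :> R by rewrite pnatr_eq0 -lt0n.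
have dq : den (pt2 (a%:~R / q%:R) (b%:~R / q%:R) : 'cV[R]_2) = q.
  apply: min_nat_unique => [|d [d0 dy]].
    by split=> // i; rewrite mxE; case: ifP => _; rewrite mulrC divfK // intr_int.
  have [da db] := (dy 0, dy 1); rewrite !mxE /= in da db.
  have : (d%:R / q%:R : R) \is a Num.int.
    have -> : d%:R / q%:R = u%:~R * (d%:R * (a%:~R / q%:R))
        + v%:~R * (d%:R * (b%:~R / q%:R)) + w%:~R * d%:R :> R.
      have := congr1 (intr : int -> R) uvw; rewrite !rmorphD !rmorphM /= => uvwR.
      transitivity (d%:R / q%:R * 1%:~R : R); first by rewrite mulr1.
      by rewrite -uvwR -[(q%:Z)%:~R]/(q%:R : R); field.
    by rewrite !rpredD // rpredM // ?intr_int ?natr_int.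
  move=> /intrP[m dqm].
  have : (d%:Z)%:~R = (m * q%:Z)%:~R :> R by rewrite intrM -dqm divfK.
  move=> /intr_inj dm; have m0 : 0 < m by nia.
  nia.
split=> //; rewrite /homog dq /hvec scale_col_mx; congr col_mx.
  by apply/colP=> i; rewrite !mxE; case: ifP => _; rewrite mulrC divfK.
by rewrite scale_scalar_mx mulr1.
Qed.

Definition triple (T : Type) (a b c : T) (i : 'I_3) : T :=
  match val i with 0%N => a | 1%N => b | _ => c end.

(** (p, 0, d) and (p, 1, d) span the lattice plane d a = p c; together with
    (s, 0, q) they have determinant +1 or -1, so that Cramer's rule solves for
    integral coordinates. *)
Lemma Zbasis_normal (p d s q : int) :
  s * d - q * p = 1 \/ s * d - q * p = -1 ->
  is_Zbasis (@Zlattice R (2 + 1))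
    (triple (hvec p 0 d) (hvec p 1 d) (hvec s 0 q)).
Proof.
move=> det1.
(* Being a sign, e is its own inverse, so multiplying by e replaces division by
   the determinant. *)
pose e := s * d - q * p; have ee : e * e = 1.
  by rewrite /e; case: det1 => ->; rewrite ?mulrNN mulr1.
have sumE (a : 'I_(2 + 1) -> int) :
    \sum_i triple (hvec p 0 d) (hvec p 1 d) (hvec s 0 q) i *~ a i
    = hvec (p * a 0 + p * a 1 + s * a 2) (a 1) (d * a 0 + d * a 1 + q * a 2).
  rewrite !big_ord_recl big_ord0 addr0 /triple /= !hvecMz !hvecD.
  have -> : lift ord0 ord0 = 1 :> 'I_3 by apply: val_inj.
  have -> : lift ord0 (lift ord0 ord0) = 2 :> 'I_3 by apply: val_inj.
  by rewrite !mul0r mul1r add0r addr0 !addrA.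
split=> [a|].
  rewrite sumE => E; have [] := hvec_inj (etrans E (_ : 0 = hvec 0 0 0)).
    by have := hvecMz 0 0 0 0; rewrite mulr0z !mul0r.
  move=> E0 a1 E2.
  have a2 : a 2 = 0.
    rewrite -[a 2]mul1r -ee.
    transitivity (e * (d * (p * a 0 + p * a 1 + s * a 2)
      - p * (d * a 0 + d * a 1 + q * a 2))); first by rewrite /e; ring.
    by rewrite E0 E2; ring.
  have a0 : a 0 = 0.
    rewrite -[a 0]mul1r -ee.
    transitivity (e * (s * (d * a 0 + d * a 1 + q * a 2)
      - q * (p * a 0 + p * a 1 + s * a 2)) - e * e * a 1); first by rewrite /e; ring.
    by rewrite E0 E2 a1; ring.
  case=> [[|[|[|//]]] lti]; [rewrite -[RHS]a0 | rewrite -[RHS]a1 | rewrite -[RHS]a2];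
    by congr (a _); apply: val_inj.
apply/seteqP; split=> [u /Zlattice_hvec[x [y [z ->]]]|_ [a ->]] /=; last first.
  by rewrite sumE; apply/Zlattice_hvec; do 3!eexists.
exists (triple (e * (s * z - q * x) - y) y (e * (d * x - p * z))).
rewrite sumE /triple /=; congr hvec.
  by transitivity (e * e * x); [rewrite ee mul1r | rewrite /e; ring].
by transitivity (e * e * z); [rewrite ee mul1r | rewrite /e; ring].
Qed.

End NormalFormInvariant.

(** * Recovering the orbit from the two invariants *)

Section Classification.
Variable R : realType.

(** The triangle has vertices (r, 0), (r, 1 / d) and (s / q, 0), where
    s d - q p is 1 or -1. *)
Lemma regular_simplex_normal (r : rat) (q : nat) : inverse_dens r q ->
  exists v : 'I_3 -> 'cV[R]_2, [/\ regular_simplex v,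
    forall i, i != 2 -> v i 0 0 = ratr r & den (v 2) = q].
Proof.
move=> [q0 [s det1]].
have d0 : (0 < `|denq r|)%N by rewrite absz_gt0 denq_neq0.
have dE : denq r = `|denq r|%N :> int by rewrite gtz0_abs.
have dR : (`|denq r|%N%:R : R) = (denq r)%:~R by rewrite {2}dE.
have rE : ratr r = (numq r)%:~R / (`|denq r|%N)%:R :> R.
  by rewrite dR -{1}(divq_num_den r) fmorph_div /= !ratr_int.
have : coprimez (numq r) (denq r) by rewrite coprimezE coprime_num_den.
move=> /coprimezP[[u v] /= uv].
have uvd (b : int) : u * numq r + 0 * b + v * `|denq r|%N%:Z = 1.
  by rewrite -dE mul0r addr0.
have [den0 hom0] := @homog_pt2 R (numq r) 0 u 0 v `|denq r|%N d0 (uvd _).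
have [den1 hom1] := @homog_pt2 R (numq r) 1 u 0 v `|denq r|%N d0 (uvd _).
have [e det1'] : exists e : int, e * (s * denq r - q%:Z * numq r) = 1.
  by case: det1 => ->; [exists 1 | exists (-1)].
have uvq : e * denq r * s + 0 * 0 + - e * numq r * q%:Z = 1.
  by rewrite -det1'; ring.
have [den2 hom2] := homog_pt2 R q0 uvq.
rewrite -dE in hom0 hom1.
set v0 := pt2 _ _ in den0 hom0; set v1 := pt2 _ _ in den1 hom1.
set v2 := pt2 _ _ in den2 hom2.
exists (triple v0 v1 v2); split=> //; last first.
  by case=> [[|[|[|//]]] lti] //= _; rewrite /triple /= mxE rE.
split.
- apply: mxrank_unit; rewrite unitmxE unitfE det2 !mxE /triple /=.
  have qR : q%:R != 0 :> R by rewrite pnatr_eq0 -lt0n.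
  have dR0 : (`|denq r|%N)%:R != 0 :> R by rewrite pnatr_eq0 -lt0n.
  rewrite subrr mul0r sub0r oppr_eq0 mul0r subr0 mulf_neq0 //; last first.
    by rewrite mul1r invr_eq0.
  rewrite -(inj_eq (mulIf (mulf_neq0 qR dR0))) mul0r.
  have -> : (s%:~R / q%:R - (numq r)%:~R / (`|denq r|%N)%:R)
            * (q%:R * (`|denq r|%N)%:R)
     = (s * denq r - q%:Z * numq r)%:~R :> R.
    rewrite rmorphB !rmorphM /= -dR; field.
    by rewrite dR0 qR.
  by rewrite intr_eq0; case: det1 => ->.
- have rat_quot (a b : int) (m : nat) :
    rational_point (pt2 (a%:~R / m%:R : R) (b%:~R / m%:R)).
    move=> i; rewrite mxE; case: ifP => _; [exists (a%:~R / m%:R) | exists (b%:~R / m%:R)];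
      by rewrite fmorph_div /= ratr_int ratr_nat.
  by case=> [[|[|[|//]]] lti]; apply: rat_quot.
- exists (triple (hvec R (numq r) 0 (denq r)) (hvec R (numq r) 1 (denq r))
                 (hvec R s 0 q)).
  split; first exact: Zbasis_normal.
  move=> i; exists i; case: i => [[|[|[|//]]] lti]; rewrite /triple /=.
  + exact: hom0.
  + exact: hom1.
  + exact: hom2.
Qed.

(** The vertices on the line have denominator at least d, which is no less
    than the smallest admissible denominator of the opposite vertex. *)
Lemma c_pt_normal (r : rat) (y : R) : irrational y ->
  c_pt (pt2 (ratr r) y) = min_nat (inverse_dens r).
Proof.
move=> irr_y; rewrite /c_pt /c_aff Fspace_normal //; apply: eq_min_nat.
  move=> q /regular_simplex_normal[v [reg_v v_on den_v]].
  exists 1%N, v; split=> //; last by exists 2.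
    exists (pt2 (ratr r) 0), (pt2 0 1); split.
      apply/eqP; rewrite eqn_leq rank_leq_col lt0n mxrank_eq0.
      apply/eqP=> /colP/(_ 1); rewrite !mxE /= => /eqP; exact/negP/oner_neq0.
    apply/seteqP; split=> [z zr|_ [a ->]] /=; last first.
      by rewrite !mxE big_ord1 !mxE mul0r addr0.
    exists ((z 1 0)%:M); rewrite [LHS]pt2E [RHS]pt2E !mxE !big_ord1 !mxE /=.
    by rewrite zr mul0r addr0 mul1r add0r mulr1n.
  by move=> i i1; apply: v_on; apply: contraTneq i1 => ->.
move=> _ [e [v [dimL reg_v v_on [i ->]]]].
(* The line has more than one point, so at least the two vertices v 0 and v 1
   are required to lie on it, whatever e > 0 is. *)
have e_gt0 : (0 < e)%N.
  rewrite lt0n; apply/negP=> /eqP e0; move: dimL; rewrite e0 => -[p [B [_ LE]]].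
  have Lp (z : 'cV[R]_2) : z 0 0 = ratr r -> z = p.
    move=> zr; have : [set z : 'cV[R]_2 | z 0 0 = ratr r] z by [].
    by rewrite LE => -[a ->]; rewrite thinmx0 mul0mx addr0.
  have : pt2 (ratr r) 0 = pt2 (ratr r) 1 :> 'cV[R]_2.
    by transitivity p; [|apply: esym]; apply: Lp; rewrite mxE.
  by move=> /colP/(_ 1); rewrite !mxE /= => /esym/eqP; exact/negP/oner_neq0.
have on_line (k : 'I_3) : k != 2 -> v k 0 0 = ratr r.
  move=> k2; apply: (v_on k); apply: leq_trans e_gt0.
  by case: k k2 => [[|[|[|//]]] lti].
have [->|i2] := eqVneq i 2.
  by exists (den (v 2)) => //; apply: den_vertex_opposite.
have [q rq le_q] := inverse_dens_le r; exists q => //.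
apply: leq_trans le_q _; apply: (den_vertex_on_line (R := R)) (on_line _ i2).
by case: reg_v.
Qed.

(** Comparing irrational parts, r lies in Z + Z r', hence has a denominator
    dividing that of r'. *)
Lemma denq_dvd_Ggroup (r r' : rat) (y y' : R) : irrational y' ->
  Ggroup (pt2 (ratr r) y) `<=` Ggroup (pt2 (ratr r') y') ->
  (denq r %| denq r')%Z.
Proof.
move=> irr_y' sub_rr'.
have : Ggroup (pt2 (ratr r) y) (ratr r).
  by apply/Ggroup_pt2; exists 0, 1, 0; ring.
move=> /sub_rr' /Ggroup_pt2[m [a [b rE]]].
have b0 : b = 0.
  apply/eqP/negP=> /negP b0; apply: (irr_y' ((r - m%:~R - a%:~R * r') / b%:~R)).
  have bR : b%:~R != 0 :> R by rewrite intr_eq0.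
  apply: (mulfI bR); rewrite fmorph_div /= ratr_int [RHS]mulrC divfK //.
  by rewrite !rmorphB rmorphM /= !ratr_int rE; ring.
apply: (denq_dvd (R := R)); rewrite rE b0 mul0r addr0 mulrDr mulrCA denq_mul_ratr.
by rewrite rpredD // rpredM // intr_int.
Qed.

Lemma denq_eq_Ggroup (r r' : rat) (y y' : R) : irrational y -> irrational y' ->
  Ggroup (pt2 (ratr r) y) = Ggroup (pt2 (ratr r') y') -> denq r = denq r'.
Proof.
move=> irr_y irr_y' GG'.
have : (denq r %| denq r')%Z.
  by apply: (denq_dvd_Ggroup (y := y) irr_y'); rewrite GG'.
have : (denq r' %| denq r)%Z.
  by apply: (denq_dvd_Ggroup (y := y') irr_y); rewrite GG'.
rewrite !dvdzE => d'd dd'; have /eqP : (`|denq r| == `|denq r'|)%N.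
  by rewrite eqn_dvd dd' d'd.
by have := denq_gt0 r; have := denq_gt0 r'; lia.
Qed.

(** The common value q of the minima satisfies q p = - f and q p' = - f' modulo d,
    with signs f, f'.  Cross-multiplying, f f' p = p' modulo d. *)
Lemma numq_congr (r r' : rat) : denq r = denq r' ->
  min_nat (inverse_dens r) = min_nat (inverse_dens r') ->
  exists e k : int, (e = 1 \/ e = -1) /\ r' = e%:~R * r + k%:~R.
Proof.
move=> dd' cc'.
have exq p : exists q, inverse_dens p q.
  by have [q pq _] := inverse_dens_le p; exists q.
have [[q0 [s det1]] _] := min_natP (exq r).
have [[_ [s' det1']] _] := min_natP (exq r').
rewrite -{}cc' in det1'; set q := min_nat _ in q0 det1 det1'.
pose f := s * denq r - q%:Z * numq r; pose f' := s' * denq r' - q%:Z * numq r'.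
exists (f * f').
have ff : f * f = 1 by rewrite /f; case: det1 => ->.
have [k kE] : exists k, numq r' = f * f' * numq r + k * denq r.
  exists (f * (s * numq r' - s' * numq r)).
  transitivity (f * f * numq r'); first by rewrite ff mul1r.
  by rewrite {2}/f /f' -dd'; ring.
exists k; split.
  by rewrite /f /f'; case: det1 => ->; case: det1' => ->; [left|right|right|left].
have d0 : (denq r)%:~R != 0 :> rat by rewrite intr_eq0 denq_neq0.
apply: (mulIf d0); rewrite mulrDl -mulrA -{2}(divq_num_den r) divfK //.
by rewrite -{1}(divq_num_den r') -dd' divfK // kE !rmorphD !rmorphM.
Qed.

(** Each of y, y' lies in the group of the other point; substituting one
    expression into the other shows that the coefficient b of y in y' divides 1. *)
Lemma orb_normal (r r' : rat) (y y' : R) : irrational y -> irrational y' ->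
  Ggroup (pt2 (ratr r) y) = Ggroup (pt2 (ratr r') y') ->
  c_pt (pt2 (ratr r) y) = c_pt (pt2 (ratr r') y') ->
  orb (pt2 (ratr r) y) (pt2 (ratr r') y').
Proof.
move=> irr_y irr_y' GG'; rewrite !c_pt_normal // => cc'.
have [e [k [e1 rr']]] := numq_congr (denq_eq_Ggroup irr_y irr_y' GG') cc'.
have : Ggroup (pt2 (ratr r') y') y' by apply/Ggroup_pt2; exists 0, 0, 1; ring.
rewrite -GG' => /Ggroup_pt2[m [a [b y'E]]].
have : Ggroup (pt2 (ratr r) y) y by apply/Ggroup_pt2; exists 0, 0, 1; ring.
rewrite GG' => /Ggroup_pt2[m' [a' [b' yE]]].
have bb' : b * b' = 1.
  apply/eqP; rewrite eq_sym -subr_eq0; apply/negP=> /negP bb'.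
  (* If b b' <> 1, the substituted relation solves for y rationally. *)
  pose w : rat := (m'%:~R + a'%:~R * r' + b'%:~R * (m%:~R + a%:~R * r)).
  apply: (irr_y (w / (1 - b * b')%:~R)).
  have bR : (1 - b * b')%:~R != 0 :> R by rewrite intr_eq0.
  apply: (mulfI bR); rewrite fmorph_div /= ratr_int [RHS]mulrC divfK //.
  rewrite /w !rmorphD !rmorphM !rmorphD !rmorphM /= !ratr_int.
  rewrite rmorphN rmorphM /= mulrBl mul1r {1}yE y'E; ring.
have -> : ratr r' = e%:~R * ratr r + 0%:~R * y + k%:~R :> R.
  by rewrite rr' rmorphD rmorphM /= !ratr_int; ring.
have -> : y' = a%:~R * ratr r + b%:~R * y + m%:~R by rewrite y'E; ring.
apply: orb_pt2; rewrite mul0r subr0.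
have : b = 1 \/ b = -1.
  have /eqP := congr1 absz bb'; rewrite abszM muln_eq1 => /andP[/eqP + _].
  by lia.
by case: e1 => ->; case=> ->; [left|right|right|left].
Qed.

End Classification.

Theorem theorem6p1 (R : realType) (x : 'cV[R]_2) (hx : has_rank (Ggroup x) 2) :
  orb x = [set x' : 'cV[R]_2 | (Ggroup x, c_pt x) = (Ggroup x', c_pt x')].
Proof.
have c_pt_orb (y z : 'cV[R]_2) : orb y z -> c_pt z = c_pt y.
  by move=> [g gg ->]; apply: c_pt_affine.
apply/seteqP; split=> [x' xx'|x' [GG' cc']] /=.
  by rewrite (Ggroup_orb xx') (c_pt_orb _ _ xx').
have [r [y [irr_y xz]]] := rank2_normal_form hx.
have hx' : has_rank (Ggroup x') 2 by rewrite -GG'.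
have [r' [y' [irr_y' xz']]] := rank2_normal_form hx'.
apply: (orb_trans xz); apply: orb_trans (orb_sym xz').
apply: orb_normal => //.
  by rewrite (Ggroup_orb xz) (Ggroup_orb xz').
by rewrite (c_pt_orb _ _ xz) (c_pt_orb _ _ xz').
Qed.
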